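(* Let $H=H^{\dagger}\in\mathcal{M}_2(\mathbb{C})$ and let $A\in\mathcal{M}_3(\mathbb{C})$ be positive semidefinite with spectral decomposition $A=\sum_{k=1}^{3}\lambda_k A_k$ ($\lambda_k\geq 0$, $A_k$ rank-one spectral projectors). Define superoperators on $\mathcal{M}_2(\mathbb{C})$ by $\mathcal{L}_0(\rho)=-i[H,\rho]$, $\lambda_0=1$, and for $k=1,2,3$ $$\mathcal{L}_k(\rho)=\frac12\sum_{i,j=1}^{3}(A_k)_{ij}\big([\sigma_i,\rho\sigma_j]+[\sigma_i\rho,\sigma_j]\big),$$ set $\hat{\mathcal{L}}_k=\lambda_k\mathcal{L}_k$ ($k=0,\dots,3$) and $\Lambda=\max_{k}\|\hat{\mathcal{L}}_k\|_{1\to1}$. For $\alpha\geq0$ let $$S_2(\alpha)=e^{\frac{\alpha}{2}\hat{\mathcal{L}}_0}e^{\frac{\alpha}{2}\hat{\mathcal{L}}_1}e^{\frac{\alpha}{2}\hat{\mathcal{L}}_2}e^{\frac{\alpha}{2}\hat{\mathcal{L}}_3}e^{\frac{\alpha}{2}\hat{\mathcal{L}}_3}e^{\frac{\alpha}{2}\hat{\mathcal{L}}_2}e^{\frac{\alpha}{2}\hat{\mathcal{L}}_1}e^{\frac{\alpha}{2}\hat{\mathcal{L}}_0}.$$ Let $t>0$, let $N$ be a positive integer and $\tau=t/N$. Then $$\Big\|\exp\Big(\tau\sum_{k=0}^{3}\hat{\mathcal{L}}_k\Big)-S_2(\tau)\Big\|_{1\to1}\leq\frac{(4t\Lambda)^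3}{3N^3}.$$
   Context: $\sigma_1,\sigma_2,\sigma_3$ are the Pauli matrices. For a linear map $T$ on $\mathcal{M}_2(\mathbb{C})$, $\|T\|_{1\to1}=\sup_{\|X\|_1=1}\|T(X)\|_1$ with $\|X\|_1=\mathrm{tr}\sqrt{X^{\dagger}X}$, the supremum over all $X\in\mathcal{M}_2(\mathbb{C})$. Products of superoperators denote composition; exponentials are defined by power series. *)

(* Defs.v *)
From HB Require Import structures.
From mathcomp Require Import all_boot all_order all_algebra.
From mathcomp Require Import boolp classical_sets reals topology normedtype sequences.
From mathcomp Require Import complex.
Set Implicit Arguments. Unset Strict Implicit. Unset Printing Implicit Defensive.
Import Order.TTheory GRing.Theory Num.Theory.
Import numFieldNormedType.Exports.
Local Open Scope ring_scope.

Section QDefs.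
Variable R : realType.
Local Notation C := (R[i]).

Definition adjmx m n (M : 'M[C]_(m, n)) : 'M[C]_(n, m) :=
  \matrix_(i, j) Num.conj (M j i).

(* positive square root of a normal (in our use: positive semidefinite)
   matrix, via the spectral theorem M = P^-1 diag(d) P with P unitary *)
Definition psd_sqrt n (M : 'M[C]_n) : 'M[C]_n :=
  invmx (spectralmx M) *m diag_mx (map_mx sqrtC (spectral_diag M)) *m spectralmx M.

Definition tracenorm (X : 'M[C]_2) : R :=
  complex.Re (\tr (psd_sqrt (adjmx X *m X))).

Definition superop := 'M[C]_2 -> 'M[C]_2.

Definition opnorm11 (T : superop) : R :=
  sup [set tracenorm (T X) | X in [set X : 'M[C]_2 | tracenorm X = 1]]%classic.

Definition expS_partial (T : superop) (X : 'M[C]_2) (n : nat) : 'M[C]_2 :=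
  \sum_(k < n) (((k`!)%:R)^-1 : C) *: iter k T X.

Definition expS (T : superop) : superop := fun X =>
  \matrix_(i, j)
    Complex (limn (fun n => complex.Re (expS_partial T X n i j)))
            (limn (fun n => complex.Im (expS_partial T X n i j))).

Definition scaleS (c : R) (T : superop) : superop := fun X => (c%:C)%C *: T X.

(* Pauli matrices sigma_1, sigma_2, sigma_3 (indexed by 'I_3 = {0,1,2}) *)
Definition pauli (k : 'I_3) : 'M[C]_2 :=
  match val k with
  | 0 => \matrix_(i < 2, j < 2) (if i != j then 1 else 0)
  | 1 => \matrix_(i < 2, j < 2)
           (if i == j then 0 else if val i == 0 then - 'i%C else 'i%C)
  | _ => \matrix_(i < 2, j < 2)
           (if i == j then (if val i == 0 then 1 else -1) else 0)
  end.

Definition comm2 (X Y : 'M[C]_2) : 'M[C]_2 := X *m Y - Y *m X.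

Definition L0 (H : 'M[C]_2) : superop := fun rho => (- 'i%C) *: comm2 H rho.

Definition LB (B : 'M[C]_3) : superop := fun rho =>
  (2%:R)^-1 *: \sum_(i < 3) \sum_(j < 3)
     B i j *: (comm2 (pauli i) (rho *m pauli j) + comm2 (pauli i *m rho) (pauli j)).

(* hat L_k, k = 0..3 : hat L_0 = L_0 (lambda_0 = 1), hat L_{k+1} = lambda_k L_{A_k} *)
Definition Lhat (H : 'M[C]_2) (lam : 'I_3 -> R) (Ak : 'I_3 -> 'M[C]_3)
  (k : 'I_4) : superop :=
  match val k with
  | 0 => L0 H
  | 1 => scaleS (lam 0) (LB (Ak 0))
  | 2 => scaleS (lam 1) (LB (Ak 1))
  | _ => scaleS (lam 2) (LB (Ak 2))
  end.

Definition S2 (H : 'M[C]_2) (lam : 'I_3 -> R) (Ak : 'I_3 -> 'M[C]_3) (a : R)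
  : superop :=
  let E k := expS (scaleS (a / 2) (Lhat H lam Ak k)) in
  E 0 \o E 1 \o E 2 \o E 3 \o E 3 \o E 2 \o E 1 \o E 0.

Definition herm_mx n (M : 'M[C]_n) : Prop := adjmx M = M.

Definition psd_mx n (M : 'M[C]_n) : Prop :=
  herm_mx M /\ forall v : 'rV[C]_n, 0 <= (v *m M *m adjmx v) 0 0.

End QDefs.

(* Main.v *)
Require Import Defs.
From HB Require Import structures.
From mathcomp Require Import all_boot all_order all_algebra.
From mathcomp Require Import boolp classical_sets.
From mathcomp Require Import reals topology normedtype sequences exp.
From mathcomp Require Import complex.
From mathcomp Require Import ring lra.
Set Implicit Arguments. Unset Strict Implicit. Unset Printing Implicit Defensive.
Import Order.TTheory GRing.Theory Num.Theory.
Import numFieldNormedType.Exports.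
Local Open Scope ring_scope.

(** Write [x = 4 tau Lambda].  The trace norm is dual to the operator norm, so a
    completely positive map [X |-> sum_i K_i X K_i^*] has trace norm at most
    [c] as soon as [sum_i K_i^* K_i <= c].  Applied to the Kraus operators of an
    Euler step this gives [|1 + h L| <= 1 + O(h^2)] for every Lindblad generator
    [L], hence every [exp L] is a contraction on all of [M_2(C)].

    If the remainders [P - 1], [P - 1 - A_1] and [P - 1 - A_1 - A_2] are bounded
    by [y], [y^2/2] and [y^3/6], and likewise for [Q] with [z], then, [P] being a
    contraction, the same holds for [P Q] with [y + z].  Since [exp L] is the
    limit of [(1 + L/M)^M], the Taylor remainders of [exp L] are bounded as in
    the scalar case but without an exponential factor, and so are those of
    [S_2(tau)].  Both operators have the same terms up to second order, and each
    third order remainder is at most [x^3/6]. *)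

(** * Real and imaginary parts of complex numbers *)

Section ComplexParts.
Variable R : realType.
Implicit Types x y : R[i].

Lemma ReD x y : complex.Re (x + y) = complex.Re x + complex.Re y.
Proof. by case: x y => [a b] [c d]. Qed.

Lemma ReN x : complex.Re (- x) = - complex.Re x.
Proof. by case: x. Qed.

Lemma ReM x y :
  complex.Re (x * y) = complex.Re x * complex.Re y - complex.Im x * complex.Im y.
Proof. by case: x y => [a b] [c d]. Qed.

Lemma ImD x y : complex.Im (x + y) = complex.Im x + complex.Im y.
Proof. by case: x y => [a b] [c d]. Qed.

Lemma ImN x : complex.Im (- x) = - complex.Im x.
Proof. by case: x. Qed.

Lemma ReZ (a : R) x : complex.Re (a%:C%C * x) = a * complex.Re x.
Proof. by rewrite ReM /= mul0r subr0. Qed.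

Lemma Re_conj x : complex.Re (Num.conj x) = complex.Re x.
Proof. by case: x. Qed.

Lemma Im_conj x : complex.Im (Num.conj x) = - complex.Im x.
Proof. by case: x. Qed.

Lemma Re_sum I (r : seq I) (P : pred I) (F : I -> R[i]) :
  complex.Re (\sum_(i <- r | P i) F i) = \sum_(i <- r | P i) complex.Re (F i).
Proof. by apply: (big_morph _ ReD). Qed.

Lemma Im_sum I (r : seq I) (P : pred I) (F : I -> R[i]) :
  complex.Im (\sum_(i <- r | P i) F i) = \sum_(i <- r | P i) complex.Im (F i).
Proof. by apply: (big_morph _ ImD). Qed.

End ComplexParts.

(** * Adjoints, the Hilbert-Schmidt form, and duality between trace norm and operator norm *)

Section Adjoint.
Variable R : realType.
Local Notation C := R[i].

Lemma adjmxK m n (M : 'M[C]_(m, n)) : adjmx (adjmx M) = M.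
Proof. by apply/matrixP=> i j; rewrite !mxE conjCK. Qed.

Lemma adjmxD m n (M N : 'M[C]_(m, n)) : adjmx (M + N) = adjmx M + adjmx N.
Proof. by apply/matrixP=> i j; rewrite !mxE rmorphD. Qed.

Lemma adjmxZ m n (c : C) (M : 'M[C]_(m, n)) :
  adjmx (c *: M) = Num.conj c *: adjmx M.
Proof. by apply/matrixP=> i j; rewrite !mxE rmorphM. Qed.

Lemma adjmxN m n (M : 'M[C]_(m, n)) : adjmx (- M) = - adjmx M.
Proof. by apply/matrixP=> i j; rewrite !mxE rmorphN. Qed.

Lemma adjmx0 m n : adjmx (0 : 'M[C]_(m, n)) = 0.
Proof. by apply/matrixP=> i j; rewrite !mxE rmorph0. Qed.

Lemma adjmx1 n : adjmx (1%:M : 'M[C]_n) = 1%:M.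
Proof. by apply/matrixP=> i j; rewrite !mxE rmorph_nat eq_sym. Qed.

Lemma adjmxM m n p (M : 'M[C]_(m, n)) (N : 'M[C]_(n, p)) :
  adjmx (M *m N) = adjmx N *m adjmx M.
Proof.
apply/matrixP=> i j; rewrite !mxE rmorph_sum; apply: eq_bigr => k _.
by rewrite !mxE rmorphM mulrC.
Qed.

Lemma conj_realC (a : R) : Num.conj (a%:C%C) = a%:C%C.
Proof. exact: conjc_real. Qed.

Definition rtr n (M : 'M[C]_n) : R := complex.Re (\tr M).

Lemma rtrD n (M N : 'M[C]_n) : rtr (M + N) = rtr M + rtr N.
Proof. by rewrite /rtr mxtraceD ReD. Qed.

Lemma rtrN n (M : 'M[C]_n) : rtr (- M) = - rtr M.
Proof. by rewrite /rtr raddfN ReN. Qed.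

Lemma rtrZ n (a : R) (M : 'M[C]_n) : rtr (a%:C%C *: M) = a * rtr M.
Proof. by rewrite /rtr mxtraceZ ReZ. Qed.

Lemma rtrC m n (M : 'M[C]_(m, n)) (N : 'M[C]_(n, m)) :
  rtr (M *m N) = rtr (N *m M).
Proof. by rewrite /rtr mxtrace_mulC. Qed.

Lemma rtr_adj n (M : 'M[C]_n) : rtr (adjmx M) = rtr M.
Proof.
rewrite /rtr /mxtrace !Re_sum; apply: eq_bigr => i _.
by rewrite mxE Re_conj.
Qed.

(** The squared Hilbert-Schmidt norm. *)
Definition hsn m n (M : 'M[C]_(m, n)) : R := rtr (adjmx M *m M).

Lemma hsnE m n (M : 'M[C]_(m, n)) :
  hsn M = \sum_i \sum_j (complex.Re (M j i) ^+ 2 + complex.Im (M j i) ^+ 2).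
Proof.
rewrite /hsn /rtr /mxtrace Re_sum; apply: eq_bigr => i _.
rewrite mxE Re_sum; apply: eq_bigr => j _.
by rewrite !mxE ReM Re_conj Im_conj mulNr opprK !expr2.
Qed.

Lemma hsn_ge0 m n (M : 'M[C]_(m, n)) : 0 <= hsn M.
Proof.
rewrite hsnE; apply: sumr_ge0 => i _; apply: sumr_ge0 => j _.
by rewrite addr_ge0 ?sqr_ge0.
Qed.

Lemma hsnD m n (M N : 'M[C]_(m, n)) :
  hsn (M + N) = hsn M + hsn N + rtr (adjmx M *m N) *+ 2.
Proof.
rewrite /hsn adjmxD mulmxDl !mulmxDr !rtrD.
have -> : rtr (adjmx N *m M) = rtr (adjmx M *m N).
  by rewrite -rtr_adj adjmxM adjmxK.
by rewrite mulr2n; ring.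
Qed.

Lemma hsnN m n (M : 'M[C]_(m, n)) : hsn (- M) = hsn M.
Proof. by rewrite /hsn adjmxN mulNmx mulmxN opprK. Qed.

Lemma hsnZ m n (c : C) (M : 'M[C]_(m, n)) :
  hsn (c *: M) = (complex.Re c ^+ 2 + complex.Im c ^+ 2) * hsn M.
Proof.
rewrite !hsnE mulr_sumr; apply: eq_bigr => i _.
rewrite mulr_sumr; apply: eq_bigr => j _; rewrite mxE.
by case: (c) (M j i) => a b [d e] /=; ring.
Qed.

Lemma hsn_young m n (M N : 'M[C]_(m, n)) :
  rtr (adjmx M *m N) *+ 2 <= hsn M + hsn N.
Proof.
have := hsn_ge0 (M - N); rewrite hsnD hsnN mulmxN rtrN; lra.
Qed.

(** Operator norm at most [c], without square roots or suprema: rescaling [U] by [s] and [V] by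
    [1/s] and optimizing over [s] turns this into [Re tr(U^* W V) <= c |U| |V|] in Hilbert-Schmidt
    norm. *)
Definition opbnd n (c : R) (W : 'M[C]_n) : Prop :=
  forall U V : 'M[C]_n, rtr (adjmx U *m W *m V) *+ 2 <= c * (hsn U + hsn V).


(* A singular value decomposition in which the singular values enter through
   their square roots [S]; [Q] is only a partial isometry. *)
Lemma tracenorm_svd (X : 'M[C]_2) : exists P Q S : 'M[C]_2,
  [/\ X = Q *m S *m S *m P, adjmx P *m P = 1%:M /\ P *m adjmx P = 1%:M,
      Q *m adjmx Q *m Q = Q, adjmx Q *m Q *m S = S /\ adjmx S = S
    & tracenorm X = rtr (S *m S)].
Proof.
pose M := adjmx X *m X; pose P := spectralmx M; pose d := spectral_diag M.
have adjE k l (Z : 'M[C]_(k, l)) : map_mx Num.conj Z^T = adjmx Z.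
  by apply/matrixP=> i j; rewrite !mxE.
have PU : P \is unitarymx by exact: spectral_unitarymx.
have PP : P *m adjmx P = 1%:M by move/unitarymxP: PU; rewrite adjE.
have PP' : adjmx P *m P = 1%:M by exact: mulmx1C.
have invP : invmx P = adjmx P by rewrite invmx_unitary // adjE.
have ME : M = adjmx P *m diag_mx d *m P.
  rewrite -invP; apply/orthomx_spectralP/normalmxP.
  by rewrite adjE /M adjmxM adjmxK.
(* The columns of [Y] are orthogonal, and their squared lengths are the eigenvalues [d] of
   [X^* X]. *)
have [Y YE] : exists Y, Y = X *m adjmx P by eexists.
have YY : adjmx Y *m Y = diag_mx d.
  rewrite YE adjmxM adjmxK mulmxA -(mulmxA P) -/M ME !mulmxA PP mul1mx.
  by rewrite -mulmxA PP mulmx1.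
have dE j : d 0 j = \sum_k `|Y k j| ^+ 2.
  have /matrixP/(_ j j) := YY; rewrite !mxE eqxx mulr1n => <-.
  by apply: eq_bigr => k _; rewrite !mxE mulrC normCK.
have d_ge0 j : 0 <= d 0 j.
  by rewrite dE sumr_ge0 // => k _; rewrite exprn_ge0.
pose s j := sqrtC (d 0 j).
have s_ge0 j : 0 <= s j by rewrite sqrtC_ge0.
have sK j : s j * s j = d 0 j by rewrite -expr2 sqrtCK.
have Y0 k j : s j = 0 -> Y k j = 0.
  move=> sj0; have /eqP := dE j; rewrite -sK sj0 mul0r eq_sym psumr_eq0 => [|l _].
    by move=> /allP/(_ k); rewrite mem_index_enum sqrf_eq0 normr_eq0 => /(_ isT)/eqP.
  by rewrite exprn_ge0.
pose S := diag_mx (\row_j sqrtC (s j)).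
(* As [0^-1 = 0], a vanishing singular value gives a zero column of [Q]; the other columns are
   orthonormal. Hence [Q^* Q] is the projection onto the support of [S]. *)
pose Q := Y *m diag_mx (\row_j (s j)^-1).
have SS : S *m S = diag_mx (\row_j s j).
  apply/matrixP=> i j; rewrite mul_diag_mx !mxE.
  by case: eqP => [->|_]; rewrite ?mulr0n ?mulr0 // !mulr1n -expr2 sqrtCK.
have QQ : adjmx Q *m Q = diag_mx (\row_j (s j != 0)%:R).
  have -> : adjmx Q = diag_mx (\row_j (s j)^-1) *m adjmx Y.
    rewrite adjmxM; congr (_ *m _); apply/matrixP=> i j; rewrite !mxE rmorphMn /=.
    rewrite conj_Creal ?rpredV ?ger0_real // eq_sym.
    by case: eqP => [->|].
  rewrite mulmxA -(mulmxA (diag_mx _)) YY; apply/matrixP=> i j.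
  rewrite mul_mx_diag mul_diag_mx !mxE.
  case: (i =P j) => [->|_]; last by rewrite !mulr0n mulr0 mul0r.
  rewrite !mulr1n -sK; have [->|sj0] := eqVneq (s j) 0.
    by rewrite invr0 !mul0r.
  by rewrite mulrA mulVf // mul1r divff.
exists P, Q, S; split=> //.
- rewrite -(mulmxA Q) SS /Q -(mulmxA Y).
  have -> : Y *m (diag_mx (\row_j (s j)^-1) *m diag_mx (\row_j s j)) = Y.
    apply/matrixP=> i j; rewrite mulmxA !mul_mx_diag !mxE.
    have [sj0|sj0] := eqVneq (s j) 0; first by rewrite Y0 // !mul0r.
    by rewrite mulfVK.
  by rewrite YE -mulmxA PP' mulmx1.
- rewrite -mulmxA QQ /Q; apply/matrixP=> i j; rewrite !mul_mx_diag !mxE.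
  move: (s j) => z; have [->|_] := eqVneq z 0; last by rewrite mulr1.

  by rewrite invr0 !mulr0.
- split; last first.
    apply/matrixP=> i j; rewrite !mxE rmorphMn /= conj_Creal ?ger0_real ?sqrtC_ge0 //.
    by rewrite eq_sym; case: eqP => [->|].
  rewrite QQ; apply/matrixP=> i j; rewrite mul_diag_mx !mxE.
  case: (i =P j) => [->|_]; last by rewrite mulr0n mulr0.
  rewrite !mulr1n; have [->|_] := eqVneq (s j) 0; last by rewrite mul1r.
  by rewrite sqrtC0 mulr0.
- rewrite /tracenorm -/(rtr _) /psd_sqrt -/M -/P -/d rtrC mulmxA mulmxV ?unitarymx_unit //.
  rewrite mul1mx SS; congr (rtr (diag_mx _)).
  by apply/rowP=> j; rewrite !mxE.
Qed.

(** For [X = Q S S P], cyclicity moves one factor [S] to each side of [W]: the trace is the form of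
    [W] at [P^* S] and [Q S], both of squared length [tr(S S)], which is the trace norm. *)
Lemma rtr_le_tracenorm (c : R) (W X : 'M[C]_2) :
  opbnd c W -> rtr (W *m X) <= c * tracenorm X.
Proof.
have [P [Q [S [-> [_ PP] _ [QQS Sa] ->]]]] := tracenorm_svd X.
move=> /(_ (adjmx P *m S) (Q *m S)).
rewrite /hsn !adjmxM adjmxK Sa.
have -> : S *m P *m (adjmx P *m S) = S *m S.
  by rewrite mulmxA -(mulmxA S) PP mulmx1.
have -> : S *m adjmx Q *m (Q *m S) = S *m S.
  by rewrite -!mulmxA (mulmxA (adjmx Q)) QQS.
have -> : rtr (S *m P *m W *m (Q *m S)) = rtr (W *m (Q *m S *m S *m P)).
  by rewrite [LHS]rtrC [RHS]rtrC !mulmxA.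
lra.
Qed.

Lemma tracenorm_attained (X : 'M[C]_2) :
  exists2 W, opbnd 1 W & rtr (W *m X) = tracenorm X.
Proof.
have [P [Q [S [-> [PP PP'] QQQ [QQS Sa] ->]]]] := tracenorm_svd X.
(* The adjoint of the polar factor [Q P] of [X]. *)
exists (adjmx P *m adjmx Q) => [U V|]; last first.
  rewrite rtrC !mulmxA -(mulmxA _ P) PP' mulmx1 rtrC !mulmxA.
  by rewrite QQS.
have hU : hsn (P *m U) = hsn U.
  by rewrite /hsn adjmxM mulmxA -(mulmxA _ _ P) PP mulmx1.
have hV : hsn (adjmx Q *m V) <= hsn V.
  (* [Q Q^*] is an orthogonal projection, so this squared length is [|V|^2 - |Q^* V|^2]. *)
  have := hsn_ge0 (V - Q *m adjmx Q *m V); rewrite hsnD hsnN.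
  have -> : hsn (Q *m adjmx Q *m V) = hsn (adjmx Q *m V).
    rewrite /hsn !adjmxM !adjmxK !mulmxA.
    by rewrite -(mulmxA (adjmx V) Q) -(mulmxA (adjmx V)) QQQ !mulmxA.
  have -> : rtr (adjmx V *m - (Q *m adjmx Q *m V)) = - hsn (adjmx Q *m V).
    by rewrite mulmxN rtrN /hsn adjmxM adjmxK !mulmxA.
  lra.
have := hsn_young (P *m U) (adjmx Q *m V).
rewrite adjmxM !mulmxA; lra.
Qed.

End Adjoint.

(** * The trace norm as a norm, and bounded superoperators *)

Section TraceNorm.
Variable R : realType.
Local Notation C := R[i].
Local Notation V := 'M[C]_2.
Local Notation tn := (@tracenorm R).
Implicit Types (X Y : V) (T : superop R).

Lemma tn_ge0 X : 0 <= tn X.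
Proof.
have : opbnd 1 (0 : V).
  move=> U W; rewrite mulmx0 mul0mx /rtr mxtrace0 mul0rn mul1r.
  by rewrite addr_ge0 ?hsn_ge0.
by move/rtr_le_tracenorm => /(_ X); rewrite mul0mx /rtr mxtrace0 mul1r.
Qed.

Lemma tn0 : tn 0 = 0.
Proof. by have [W _ <-] := tracenorm_attained (0 : V); rewrite mulmx0 /rtr mxtrace0. Qed.

(** By duality the trace norm is a maximum of linear functionals. *)
Lemma tnD X Y : tn (X + Y) <= tn X + tn Y.
Proof.
have [W Wb <-] := tracenorm_attained (X + Y).
by rewrite mulmxDr rtrD -(mul1r (tn X)) -(mul1r (tn Y)) lerD ?rtr_le_tracenorm.
Qed.

Lemma tnN X : tn (- X) = tn X.
Proof.
suff le Y : tn (- Y) <= tn Y.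
  by apply/le_anti/andP; split; [exact: le | have := le (- X); rewrite opprK].
have [W Wb <-] := tracenorm_attained (- Y).
rewrite mulmxN -mulNmx -(mul1r (tn Y)); apply: rtr_le_tracenorm => U Z.
have := Wb (- U) Z.
by rewrite hsnN adjmxN mulmxN !mulNmx.
Qed.

Lemma tnB X Y : tn (X - Y) <= tn X + tn Y.
Proof. by rewrite -(tnN Y) tnD. Qed.

Lemma tnZ (a : R) X : tn (a%:C%C *: X) = `|a| * tn X.
Proof.
wlog a_ge0 : a / 0 <= a => [hw|].
  have [/hw//|a_lt0] := leP 0 a.
  by rewrite -tnN -scaleNr -raddfN /= hw ?oppr_ge0 ?(ltW a_lt0) // normrN.
(* Duality gives this inequality; the reverse one is its instance for the factor [a^-1] and the
   matrix [a X]. *)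
have le b Y : 0 <= b -> tn (b%:C%C *: Y) <= b * tn Y.
  move=> b0; have [W Wb <-] := tracenorm_attained (b%:C%C *: Y).
  rewrite -scalemxAr rtrZ ler_wpM2l //.
  by rewrite -(mul1r (tn Y)) rtr_le_tracenorm.
rewrite ger0_norm //; have [->|a0] := eqVneq a 0.
  by rewrite rmorph0 scale0r mul0r tn0.
apply/le_anti; rewrite le //=.
have := @le a^-1 (a%:C%C *: X).
rewrite invr_ge0 => /(_ a_ge0); rewrite scalerA -rmorphM mulVf // rmorph1 scale1r.
by rewrite ler_pdivlMl // lt_def a0.
Qed.

Lemma tn_sum I (r : seq I) (P : pred I) (F : I -> V) :
  tn (\sum_(i <- r | P i) F i) <= \sum_(i <- r | P i) tn (F i).
Proof.
elim/big_rec2: _ => [|i y x _ IH]; first by rewrite tn0.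
by rewrite (le_trans (tnD _ _)) // lerD2l.
Qed.

Lemma hsn_delta (i j : 'I_2) (c : C) (U : V) :
  complex.Re c ^+ 2 + complex.Im c ^+ 2 = 1 -> hsn (c *: delta_mx j i *m U) <= hsn U.
Proof.
move=> c1; rewrite -scalemxAl hsnZ c1 mul1r !hsnE; apply: ler_sum => l _.
rewrite (bigD1 j) //= big1 => [|k /negPf kj]; last first.
  by rewrite mxE big1 ?expr0n ?addr0 //= => m _; rewrite mxE kj mul0r.
rewrite [in leRHS](bigD1 i) //= lerD //; last first.
  by apply: sumr_ge0 => k _; rewrite addr_ge0 ?sqr_ge0.
rewrite !mxE (bigD1 i) //= big1 => [|m /negPf mi]; last by rewrite !mxE mi andbF mul0r.
by rewrite !mxE !eqxx mul1r addr0.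
Qed.

(** The left side is the pairing of [X] with [c] times a matrix unit, which is a contraction. The
    phases 1, -1 and [±i] extract the signed real and imaginary parts of the entry. *)
Lemma entry_le_tn X i j (c : C) :
  complex.Re c ^+ 2 + complex.Im c ^+ 2 = 1 -> complex.Re (c * X i j) <= tn X.
Proof.
move=> c1.
have -> : complex.Re (c * X i j) = rtr (c *: delta_mx j i *m X).
  rewrite /rtr -scalemxAl mxtraceZ; congr (complex.Re (c * _)).
  rewrite /mxtrace (bigD1 j) //= big1 => [|k /negPf kj]; last first.
    by rewrite mxE big1 // => m _; rewrite mxE kj mul0r.
  rewrite mxE (bigD1 i) //= big1 => [|m /negPf mi]; last by rewrite !mxE mi andbF mul0r.
  by rewrite !mxE !eqxx mul1r !addr0.
rewrite -(mul1r (tn X)); apply: rtr_le_tracenorm => U W.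
rewrite -mulmxA mul1r (le_trans (hsn_young _ _)) // lerD2l.
exact: hsn_delta.
Qed.

Lemma Re_le_tn X i j : `|complex.Re (X i j)| <= tn X.
Proof.
rewrite ler_norml lerNl; apply/andP; split.
  rewrite -ReN -mulN1r; apply: entry_le_tn => /=; lra.
by rewrite -(mul1r (X i j)); apply: entry_le_tn => /=; lra.
Qed.

Lemma Im_le_tn X i j : `|complex.Im (X i j)| <= tn X.
Proof.
have ImE : complex.Im (X i j) = complex.Re (- 'i%C * X i j).
  by case: (X i j) => a b /=; lra.
rewrite ler_norml lerNl ImE; apply/andP; split.
  by rewrite -ReN -mulNr; apply: entry_le_tn => /=; lra.
by apply: entry_le_tn => /=; lra.
Qed.

Lemma tn_eq0 X : tn X = 0 -> X = 0.
Proof.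
move=> X0; apply/matrixP=> i j; rewrite mxE.
have := Re_le_tn X i j; have := Im_le_tn X i j; rewrite X0 !normr_le0.
by case: (X i j) => a b /= /eqP -> /eqP ->.
Qed.

Definition bnd (c : R) T := forall X, tn (T X) <= c * tn X.

Lemma linD T : linear T -> forall X Y, T (X + Y) = T X + T Y.
Proof. by move=> lT X Y; have := lT 1 X Y; rewrite !scale1r. Qed.

Lemma lin0 T : linear T -> T 0 = 0.
Proof. by move=> lT; have := linD lT 0 0; rewrite addr0 -{1}(addr0 (T 0)) => /addrI. Qed.

Lemma linZ T : linear T -> forall c X, T (c *: X) = c *: T X.
Proof. by move=> lT c X; have := lT c X 0; rewrite !addr0 lin0 // addr0. Qed.

Lemma lin_sum T : linear T -> forall I (r : seq I) (P : pred I) (F : I -> V),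
  T (\sum_(i <- r | P i) F i) = \sum_(i <- r | P i) T (F i).
Proof. by move=> lT I r P F; apply: (big_morph T (linD lT) (lin0 lT)). Qed.

(** Expansion in matrix units. It yields boundedness of linear superoperators and, for the identity,
    convergence in trace norm from entrywise convergence. *)
Lemma tn_lin_le T X : linear T -> tn (T X) <= \sum_i \sum_j
  (`|complex.Re (X i j)| * tn (T (delta_mx i j))
   + `|complex.Im (X i j)| * tn ('i%C *: T (delta_mx i j))).
Proof.
move=> lT; rewrite {1}[X]matrix_sum_delta lin_sum //.
rewrite (le_trans (tn_sum _ _ _)) //; apply: ler_sum => i _.
rewrite lin_sum // (le_trans (tn_sum _ _ _)) //; apply: ler_sum => j _.
rewrite linZ // {1}[X i j]complexE scalerDl mulrC -scalerA.
by rewrite (le_trans (tnD _ _)) // !tnZ.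
Qed.

Lemma linear_bounded T : linear T -> exists c, bnd c T.
Proof.
move=> lT; exists (\sum_i \sum_j (tn (T (delta_mx i j)) + tn ('i%C *: T (delta_mx i j)))).
move=> X; rewrite (le_trans (tn_lin_le X lT)) // mulr_suml; apply: ler_sum => i _.
rewrite mulr_suml; apply: ler_sum => j _.
rewrite mulrDl; apply: lerD; rewrite mulrC; apply: ler_wpM2l; first exact: tn_ge0.
- exact: Re_le_tn.
- exact: tn_ge0.
- exact: Im_le_tn.
Qed.

Lemma opnorm11_bnd T : linear T -> bnd (opnorm11 T) T.
Proof.
move=> lT X; have [X0|X0] := eqVneq (tn X) 0.
  by rewrite X0 mulr0 (tn_eq0 X0) lin0 // tn0.
have Xp : 0 < tn X by rewrite lt_def X0 tn_ge0.
have unit : tn ((tn X)^-1%:C%C *: X) = 1.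
  by rewrite tnZ ger0_norm ?invr_ge0 ?tn_ge0 // mulVf.
rewrite -ler_pdivrMr // mulrC -[X in X * _]ger0_norm ?invr_ge0 ?tn_ge0 //.
rewrite -tnZ -linZ //; apply: ub_le_sup; last by exists ((tn X)^-1%:C%C *: X).
(* A supremum dominates the elements of its set only if the set has an upper bound. *)
have [c cT] := linear_bounded lT.
by exists c => _ [Y /= Y1 <-]; rewrite -(mulr1 c) -Y1.
Qed.

Lemma opnorm11_le T c : 0 <= c -> bnd c T -> opnorm11 T <= c.
Proof.
move=> c0 cT; rewrite /opnorm11.
(* The supremum of the empty set is 0 by convention; [0 <= c] covers this case. *)
set A := (X in sup X); have [->|A0] := eqVneq A set0; first by rewrite sup0.
apply: ge_sup; first exact/set0P.
by move=> _ [Y /= Y1 <-]; rewrite -(mulr1 c) -Y1.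
Qed.

End TraceNorm.

(** * Scalar estimates for compound interest and the exponential *)

Section RealBounds.
Variable R : realType.
Implicit Types a b c x y z K : R.

(** The passage to the limit [M -> oo], in the form used for Euler products. *)
Lemma le_of_le_add_inv a b K :
  (forall M : nat, (0 < M)%N -> a <= b + K / M%:R) -> a <= b.
Proof.
move=> aM; apply/ler_addgt0Pr => e e0.
pose M := (Num.truncn (`|K| / e)).+1.
have M0 : (0 : R) < M%:R by rewrite ltr0n.
rewrite (le_trans (aM M _)) // lerD2l ler_pdivrMr // (le_trans (ler_norm K)) //.
by rewrite mulrC -ler_pdivrMr // ltW // truncnS_gt.
Qed.

Lemma expR_le1D z : expR z <= 1 + z * expR z.
Proof.
have := expR_ge1Dx (- z); rewrite expRN => h.
have e0 := expR_gt0 z.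
have : (1 - z) * expR z <= 1 by rewrite -ler_pdivlMr // div1r.
lra.
Qed.

Lemma expR_sub_lin z : 0 <= z -> expR z - (1 + z) <= z ^+ 2 * expR z.
Proof.
move=> z0; have h := expR_le1D z.
have : z * (expR z - 1) <= z * (z * expR z) by apply: ler_wpM2l => //; lra.
rewrite expr2 -mulrA; lra.
Qed.

(** In [a^M - b^M = (a - b) * sum a^i b^j] each of the [M] summands is at most [a^M], because
    [a >= 1]. *)
Lemma subrX_le (M : nat) a b : 1 <= a -> 0 <= b -> b <= a ->
  a ^+ M - b ^+ M <= M%:R * a ^+ M * (a - b).
Proof.
move=> a1 b0 ba; have a0 : 0 <= a by lra.
elim: M => [|M IH]; first by rewrite !expr0; lra.
have bM : b ^+ M <= a ^+ M.+1.
  rewrite (le_trans (lerXn2r M _ _ ba)) // ?nnegrE //.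
  by rewrite exprS ler_peMl // exprn_ge0.
have h1 := ler_wpM2l a0 IH.
have h2 : b ^+ M * (a - b) <= a ^+ M.+1 * (a - b) by rewrite ler_wpM2r // subr_ge0.
rewrite -natr1; rewrite exprS in h2 *; rewrite [b ^+ M.+1]exprS.
move: h1 h2; set A := a ^+ M; set B := b ^+ M; set m := M%:R.
nra.
Qed.

(** Compare the [M]-th powers of [exp(y/M)] and [1 + y/M], which differ by [O(1/M^2)]. *)
Lemma expR_compound_le (M : nat) y : (0 < M)%N -> 0 <= y ->
  expR y - (1 + y / M%:R) ^+ M <= (y ^+ 2 * expR y ^+ 2) / M%:R.
Proof.
move=> M0 y0; have M0' : (0 : R) < M%:R by rewrite ltr0n.
pose z := y / M%:R; have z0 : 0 <= z by rewrite divr_ge0 // ltW.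
have zy : z <= y by rewrite ler_pdivrMr // ler_peMr // ler1n.
have eM : expR y = expR z ^+ M.
  by rewrite -expRM_natl /z mulrC divfK // gt_eqF.
rewrite -/z eM.
have e1 : 1 <= expR z by rewrite -expR0 ler_expR.
have := @subrX_le M (expR z) (1 + z) e1; rewrite addr_ge0 // expR_ge1Dx => h.
apply: (le_trans (h isT isT)); rewrite -eM.
have h2 : expR z - (1 + z) <= z ^+ 2 * expR y.
  apply: (le_trans (expR_sub_lin z0)).
  by rewrite ler_wpM2l ?sqr_ge0 // ler_expR.
have -> : y ^+ 2 * expR y ^+ 2 / M%:R = M%:R * expR y * (z ^+ 2 * expR y).
  by rewrite /z; field; rewrite gt_eqF.
by rewrite ler_wpM2l // mulr_ge0 ?expR_ge0 // ltW.
Qed.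

(** With step size [1/M], a norm excess of order [1/M^2] per Euler step accumulates only to order
    [1/M] over [M] steps. *)
Lemma compound_sq_le (M : nat) c : (0 < M)%N -> 0 <= c ->
  (1 + c * M%:R^-1 ^+ 2) ^+ M <= 1 + (c * expR c) / M%:R.
Proof.
move=> M0 c0; have M0' : (0 : R) < M%:R by rewrite ltr0n.
have z0 : 0 <= c / M%:R by rewrite divr_ge0 // ltW.
have zc : c / M%:R <= c by rewrite ler_pdivrMr // ler_peMr // ler1n.
have h : 1 + c * M%:R^-1 ^+ 2 <= expR (c * M%:R^-1 ^+ 2) by exact: expR_ge1Dx.
have p0 : 0 <= 1 + c * M%:R^-1 ^+ 2 by rewrite addr_ge0 // mulr_ge0 // sqr_ge0.
apply: (le_trans (lerXn2r M _ _ h)); rewrite ?nnegrE ?expR_ge0 //.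
rewrite -expRM_natl.
have -> : M%:R * (c * M%:R^-1 ^+ 2) = c / M%:R by field; rewrite gt_eqF.
apply: (le_trans (expR_le1D _)); rewrite lerD2l mulrAC.
by rewrite ler_wpM2r ?invr_ge0 ?(ltW M0') // ler_wpM2l // ler_expR.
Qed.

(** The coefficients of [(1 + T/M)^M] do not exceed those of [exp T], so the difference of the two
    series has nonnegative coefficients. *)
Lemma bin_le_inv_fact (M k : nat) : (0 < M)%N ->
  'C(M, k)%:R * M%:R^-1 ^+ k <= (k`!%:R)^-1 :> R.
Proof.
move=> M0; have M0' : (0 : R) < M%:R by rewrite ltr0n.
have k0 : (0 : R) < k`!%:R by rewrite ltr0n fact_gt0.
rewrite exprVn ler_pdivrMr ?exprn_gt0 // mulrC ler_pdivlMr //.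
rewrite -natrM bin_ffact -natrX ler_nat.
by elim: k {k0} => [|k IH] //; rewrite ffactnSr expnSr leq_mul // leq_subr.
Qed.

End RealBounds.

(** * Convergence of the exponential series of a bounded superoperator *)

Section Exponential.
Variable R : realType.
Local Notation C := R[i].
Local Notation V := 'M[C]_2.
Local Notation tn := (@tracenorm R).
Local Open Scope classical_set_scope.
Variables (T : superop R) (y : R).
Hypotheses (y0 : 0 <= y) (Ty : bnd y T).
Implicit Types X Y : V.

Lemma tn_iter k X : tn (iter k T X) <= y ^+ k * tn X.
Proof.
elim: k => [|k IH]; first by rewrite expr0 mul1r.
by rewrite iterS exprS -mulrA; apply: (le_trans (Ty _)); exact: ler_wpM2l.
Qed.

Let term X k : V := ((k`!%:R)^-1 : C) *: iter k T X.

Lemma tn_exp_term X k : tn (term X k) <= exp_coeff y k * tn X.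
Proof.
have -> : term X k = ((k`!%:R)^-1)%:C%C *: iter k T X.
  by rewrite fmorphV rmorph_nat.
have k0 : (0 : R) <= k`!%:R^-1 by rewrite invr_ge0 ler0n.
rewrite tnZ (ger0_norm k0) /exp_coeff /= mulrAC mulrC.
exact: (ler_wpM2r k0 (tn_iter k X)).
Qed.

Lemma exp_series_cvg X (f : nat -> R) :
  (forall k, `|f k| <= tn (term X k)) -> cvgn (series f).
Proof.
move=> ft; apply: normed_cvg; apply: (@series_le_cvg _ _ (fun k => tn X * exp_coeff y k)).
- by move=> n /=.
- by move=> n; rewrite mulr_ge0 ?tn_ge0 // exp_coeff_ge0.
- by move=> n /=; rewrite (le_trans (ft n)) // mulrC tn_exp_term.
- rewrite -[X in cvgn X]/(series (tn X \*: exp_coeff y)).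
  exact: is_cvg_seriesZ (is_cvg_series_exp_coeff y).
Qed.

Lemma Re_partial X n i j :
  complex.Re (expS_partial T X n i j) = series (fun k => complex.Re (term X k i j)) n.
Proof. by rewrite /expS_partial summxE Re_sum /series /= big_mkord. Qed.

Lemma Im_partial X n i j :
  complex.Im (expS_partial T X n i j) = series (fun k => complex.Im (term X k i j)) n.
Proof. by rewrite /expS_partial summxE Im_sum /series /= big_mkord. Qed.

Lemma expS_partial_cvg X :
  (fun n => tn (expS T X - expS_partial T X n)) @ \oo --> (0 : R).
Proof.
pose D n := expS T X - expS_partial T X n.
(* The limits in [expS] are meaningful only for convergent sequences; domination by the scalar
   exponential series provides this for each real and imaginary part. *)
have tail0 (f d : nat -> R) : (forall k, `|f k| <= tn (term X k)) ->
    (forall n, d n = limn (series f) - series f n) -> (fun n => `|d n|) @ \oo --> (0 : R).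
  move=> /exp_series_cvg fc dE; rewrite -(normr0 R); apply: cvg_norm.
  rewrite -(subrr (limn (series f))) (funext dE).
  by apply: cvgB => //; exact: cvg_cst.
have ReD0 i j : (fun n => `|complex.Re (D n i j)|) @ \oo --> (0 : R).
  apply: (tail0 _ _ (fun k => Re_le_tn (term X k) i j)) => n.
  rewrite /D mxE [(- expS_partial _ _ _) i j]mxE ReD ReN Re_partial /expS mxE /=.
  by congr (limn _ - _); apply/funext => m; rewrite Re_partial.
have ImD0 i j : (fun n => `|complex.Im (D n i j)|) @ \oo --> (0 : R).
  apply: (tail0 _ _ (fun k => Im_le_tn (term X k) i j)) => n.
  rewrite /D mxE [(- expS_partial _ _ _) i j]mxE ImD ImN Im_partial /expS mxE /=.
  by congr (limn _ - _); apply/funext => m; rewrite Im_partial.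
apply: (@squeeze_cvgr _ _ _ _ (fun=> 0) (fun n => \sum_i \sum_j
  (`|complex.Re (D n i j)| * tn (delta_mx i j)
   + `|complex.Im (D n i j)| * tn ('i%C *: delta_mx i j)))).
- by near=> n; rewrite tn_ge0 (@tn_lin_le _ id).
- exact: cvg_cst.
have s0 : \sum_(i < 2) \sum_(j < 2)
    (0 * tn (delta_mx i j) + 0 * tn ('i%C *: delta_mx i j)) = 0.
  by apply: big1 => i _; apply: big1 => j _; rewrite !mul0r addr0.
rewrite -[X in _ --> X]s0.
have ac : continuous (fun z : R * R => z.1 + z.2) by exact: add_continuous.
apply: (cvg_big ac) => i _; apply: (cvg_big ac) => j _.
by apply: cvgD; apply: cvgMr_tmp.
Unshelve. all: by end_near. Qed.
End Exponential.

Local Opaque tracenorm expS.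

(** * Approximation of the exponential by Euler products *)

Section Euler.
Variable R : realType.
Local Notation C := R[i].
Local Notation V := 'M[C]_2.
Local Notation tn := (@tracenorm R).
Implicit Types X Y : V.

Definition euler_step (T : superop R) (h : R) : superop R := fun X => X + h%:C%C *: T X.

Variables (T : superop R) (y : R).
Hypotheses (lT : linear T) (y0 : 0 <= y) (Ty : bnd y T).

Lemma euler_stepD h X Y : euler_step T h (X + Y) = euler_step T h X + euler_step T h Y.
Proof. by rewrite /euler_step linD // scalerDr addrACA. Qed.

Lemma iter_eulerD h m X Y :
  iter m (euler_step T h) (X + Y) = iter m (euler_step T h) X + iter m (euler_step T h) Y.
Proof. by elim: m => //= m ->; rewrite euler_stepD. Qed.

(** The binomial theorem for [(1 + h T)^m]. The terms with [k > m] vanish; they are kept so that the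
    sum matches a longer partial sum of the exponential. *)
Lemma iter_eulerE h m n X : (m < n)%N -> iter m (euler_step T h) X =
  \sum_(k < n) ('C(m, k)%:R * h ^+ k)%:C%C *: iter k T X.
Proof.
elim: m n => [|m IH] [//|n] mn.
  rewrite big_ord_recl big1 => [|k _].
    by rewrite /= bin0 expr0 mulr1 rmorph1 scale1r addr0.
  by rewrite bin0n mul0r rmorph0 scale0r.
rewrite iterS (IH n.+1) ?(ltnW mn) // /euler_step [RHS]big_ord_recl /=.
have -> : \sum_(i < n) ('C(m.+1, lift ord0 i)%:R * h ^+ lift ord0 i)%:C%C *: T (iter i T X)
  = \sum_(i < n) ('C(m, i.+1)%:R * h ^+ i.+1)%:C%C *: iter i.+1 T X
   + h%:C%C *: T (\sum_(i < n) ('C(m, i)%:R * h ^+ i)%:C%C *: iter i T X).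
  rewrite lin_sum // scaler_sumr -big_split; apply: eq_bigr => i _ /=.
  rewrite (linZ lT) scalerA -scalerDl -rmorphM -rmorphD /=.
  by congr (_%:C%C *: _); rewrite /bump leq0n add1n binS natrD exprS; ring.
rewrite -IH // addrA; congr (_ + _).
  by rewrite big_ord_recl /= !bin0.
by rewrite -(IH n.+1) // ltnW.
Qed.

Definition euler (M : nat) : superop R := iter M (euler_step T M%:R^-1).

(** Since the coefficients of the difference are nonnegative, it is bounded by the same scalar
    difference with [y] in place of [T]. *)
Lemma tn_partial_euler M n X : (0 < M)%N -> (M < n)%N ->
  tn (expS_partial T X n - euler M X) <= (expR y - (1 + y / M%:R) ^+ M) * tn X.
Proof.
move=> M0 Mn; rewrite /euler (iter_eulerE _ _ Mn) /expS_partial -sumrB.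
rewrite (le_trans (tn_sum _ _ _)) //.
pose c k : R := (k`!%:R)^-1 - 'C(M, k)%:R * M%:R^-1 ^+ k.
rewrite (@le_trans _ _ (\sum_(k < n) c k * y ^+ k * tn X)) //.
  apply: ler_sum => k _.
  have -> : (k`!%:R^-1 : C) = (k`!%:R^-1)%:C%C by rewrite fmorphV rmorph_nat.
  have ck : 0 <= c k by rewrite subr_ge0 bin_le_inv_fact.
  rewrite -scalerBl -(rmorphB (real_complex R)) tnZ (ger0_norm ck).
  by rewrite -mulrA ler_wpM2l // tn_iter.
rewrite -mulr_suml ler_wpM2r ?tn_ge0 //.
have -> : \sum_(k < n) c k * y ^+ k = series (exp_coeff y) n
    - \sum_(k < n) 'C(M, k)%:R * (y / M%:R) ^+ k.
  rewrite /series /= big_mkord -sumrB; apply: eq_bigr => k _.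
  by rewrite /c /exp_coeff /= expr_div_n exprVn; ring.
have -> : \sum_(k < n) 'C(M, k)%:R * (y / M%:R) ^+ k = (1 + y / M%:R) ^+ M.
  rewrite exprDn -(big_mkord xpredT (fun k => 'C(M, k)%:R * (y / M%:R) ^+ k)).
  rewrite (big_cat_nat (n := M.+1)) //= [X in _ + X]big_nat_cond [X in _ + X]big1 ?addr0; last first.
    by move=> k /andP[/andP[Mk _] _]; rewrite bin_small // mul0r.
  rewrite big_mkord; apply: eq_bigr => k _.
  by rewrite expr1n mul1r mulr_natl.
rewrite lerD2r; apply: nondecreasing_cvgn_le; last exact: is_cvg_series_exp_coeff.
by apply: nondecreasing_series => k _ _; exact: exp_coeff_ge0.
Qed.

Lemma tn_expS_euler M X : (0 < M)%N ->
  tn (expS T X - euler M X) <= (y ^+ 2 * expR y ^+ 2) / M%:R * tn X.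
Proof.
move=> M0; apply/ler_addgt0Pr => e e0.
have /cvgr_dist_le/(_ e e0)[n0 _ h] := expS_partial_cvg y0 Ty X.
(* Large enough both for the partial sum to be [e]-close to its limit and for the binomial expansion
   to be complete. *)
pose n := maxn n0 M.+1.
have hn : tn (expS T X - expS_partial T X n) <= e.
  have := h n (leq_maxl _ _); rewrite sub0r normrN.
  exact/le_trans/ler_norm.
rewrite -(subrKA (expS_partial T X n)) (le_trans (tnD _ _)) // addrC lerD //.
rewrite (le_trans (tn_partial_euler _ M0 _)) ?leq_maxr //.
by rewrite ler_wpM2r ?tn_ge0 // expR_compound_le.
Qed.

(** Inherited from the additive Euler products in the limit. *)
Lemma expSD X Y : expS T (X + Y) = expS T X + expS T Y.
Proof.
apply/eqP; rewrite -subr_eq0; apply/eqP/tn_eq0/le_anti; rewrite tn_ge0 andbT.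
pose K := y ^+ 2 * expR y ^+ 2.
apply: (@le_of_le_add_inv _ _ _ (K * (tn (X + Y) + tn X + tn Y))) => M M0.
have -> : expS T (X + Y) - (expS T X + expS T Y) =
    (expS T (X + Y) - euler M (X + Y)) - (expS T X - euler M X) - (expS T Y - euler M Y).
  rewrite /euler iter_eulerD; move: (expS T (X + Y)) (expS T X) (expS T Y) => u v w.
  move: (iter _ _ X) (iter _ _ Y) => a b.
  by apply/matrixP=> i j; rewrite !mxE; ring.
have le3 (u v w : V) p q r : tn u <= p -> tn v <= q -> tn w <= r ->
    tn (u - v - w) <= p + q + r.
  by move=> hu hv hw; rewrite (le_trans (tnB _ _)) // lerD // (le_trans (tnB _ _)) // lerD.
have -> : 0 + K * (tn (X + Y) + tn X + tn Y) / M%:R =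
    K / M%:R * tn (X + Y) + K / M%:R * tn X + K / M%:R * tn Y.
  by move: (tn (X + Y)) (tn X) (tn Y) => p q r; ring.
exact: le3 (tn_expS_euler (X + Y) M0) (tn_expS_euler X M0) (tn_expS_euler Y M0).
Qed.

End Euler.

(** * Taylor remainders of contractions, their products and their limits *)

Section Taylor.
Variable R : realType.
Local Notation C := R[i].
Local Notation V := 'M[C]_2.
Local Notation tn := (@tracenorm R).
Implicit Types (X Y : V) (P Q T A B : superop R) (c g h y z : R).

Lemma bnd_le a b T : a <= b -> bnd a T -> bnd b T.
Proof. by move=> ab Ta X; rewrite (le_trans (Ta X)) // ler_wpM2r ?tn_ge0. Qed.

Lemma le_tnD X Y a b : tn X <= a -> tn Y <= b -> tn (X + Y) <= a + b.
Proof. by move=> Xa Yb; apply: (le_trans (tnD X Y)); exact: lerD. Qed.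

Lemma le_tnB X Y a b : tn X <= a -> tn Y <= b -> tn (X - Y) <= a + b.
Proof. by rewrite -(tnN Y); exact: le_tnD. Qed.

(* [A1] and [A2] are the first and second order terms of [P], and the
   remainders are those of an exponential of norm [y], up to the factor [g]. *)
Record taylor2 P A1 A2 y g : Prop := Taylor2 {
  taylor2D : forall X Y, P (X + Y) = P X + P Y;
  taylor2_ge0 : 0 <= y;
  taylor2_ge1 : 1 <= g;
  taylor2_rem0 : bnd g P;
  taylor2_rem1 : bnd (g * y) (fun X => P X - X);
  taylor2_rem2 : bnd (g * (y ^+ 2 / 2)) (fun X => P X - X - A1 X);
  taylor2_rem3 : bnd (g * (y ^+ 3 / 6)) (fun X => P X - X - A1 X - A2 X);
  taylor2_term1 : bnd y A1;
  taylor2_term2 : bnd (y ^+ 2 / 2) A2 }.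

(** Each remainder of [P Q] is [P] applied to the remainder of [Q], plus the remainder of [P], plus
    lower remainders of [P] applied to the terms of [Q]. Their bounds are the terms of the binomial
    expansion of [(y + z)^k / k!], up to the factor [g * g']. *)
Lemma taylor2_comp P A1 A2 y g Q B1 B2 z g' :
  taylor2 P A1 A2 y g -> taylor2 Q B1 B2 z g' ->
  taylor2 (P \o Q) (fun X => A1 X + B1 X) (fun X => A2 X + A1 (B1 X) + B2 X)
    (y + z) (g * g').
Proof.
move=> [PD y0 g1 P0 P1 P2 P3 a1 a2] [QD z0 g'1 Q0 Q1 Q2 Q3 b1 b2].
have PB X Y : P (X - Y) = P X - P Y.
  by apply/eqP; rewrite eq_sym subr_eq -PD subrK.
have g0 : 0 <= g by lra.
have g'0 : 0 <= g' by lra.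
have bndM a b A B X : 0 <= a -> bnd a A -> bnd b B -> tn (A (B X)) <= a * (b * tn X).
  by move=> a0 Aa Bb; rewrite (le_trans (Aa _)) // ler_wpM2l.
have gg w X : 0 <= w -> g * (w * tn X) <= g * g' * (w * tn X).
  by move=> w0; rewrite ler_wpM2r ?ler_peMr // mulr_ge0 ?tn_ge0.
have y2 : 0 <= y ^+ 2 / 2 by rewrite divr_ge0 ?sqr_ge0.
have z2 : 0 <= z ^+ 2 / 2 by rewrite divr_ge0 ?sqr_ge0.
have y3 : 0 <= y ^+ 3 / 6 by rewrite divr_ge0 ?exprn_ge0.
split.
- by move=> X Y /=; rewrite QD PD.
- exact: addr_ge0.
- by rewrite mulr_ege1.
- by move=> X /=; rewrite -mulrA; exact: (bndM _ _ _ _ X g0 P0 Q0).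
- move=> X /=.
  have -> : P (Q X) - X = P (Q X - X) + (P X - X).
    by rewrite PB; apply/matrixP=> i j; rewrite !mxE; ring.
  apply: (le_trans (le_tnD (bndM _ _ _ _ X g0 P0 Q1) (P1 X))).
  move: (gg y X y0); move: (tn X) => n; lra.
- move=> X /=.
  have -> : P (Q X) - X - (A1 X + B1 X)
      = P (Q X - X - B1 X) + (P X - X - A1 X) + (P (B1 X) - B1 X).
    by rewrite !PB; apply/matrixP=> i j; rewrite !mxE; ring.
  apply: (le_trans (le_tnD (le_tnD (bndM _ _ _ _ X g0 P0 Q2) (P2 X))
    (bndM _ _ _ _ X (mulr_ge0 g0 y0) P1 b1))).
  move: (gg _ X y2) (gg (y * z) X (mulr_ge0 y0 z0)); move: (tn X) => n; lra.
- move=> X /=.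
  have -> : P (Q X) - X - (A1 X + B1 X) - (A2 X + A1 (B1 X) + B2 X)
      = P (Q X - X - B1 X - B2 X) + (P X - X - A1 X - A2 X)
        + (P (B1 X) - B1 X - A1 (B1 X)) + (P (B2 X) - B2 X).
    by rewrite !PB; apply/matrixP=> i j; rewrite !mxE; ring.
  apply: (le_trans (le_tnD (le_tnD (le_tnD (bndM _ _ _ _ X g0 P0 Q3) (P3 X))
    (bndM _ _ _ _ X (mulr_ge0 g0 y2) P2 b1)) (bndM _ _ _ _ X (mulr_ge0 g0 y0) P1 b2))).
  move: (gg _ X y3) (gg (y ^+ 2 / 2 * z) X (mulr_ge0 y2 z0)).
  move: (gg (y * (z ^+ 2 / 2)) X (mulr_ge0 y0 z2)); move: (tn X) => n; lra.
- move=> X; apply: (le_trans (le_tnD (a1 X) (b1 X))).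
  by rewrite mulrDl.
- move=> X; apply: (le_trans (le_tnD (le_tnD (a2 X) (bndM _ _ _ _ X y0 a1 b1)) (b2 X))).
  move: (tn X) => n; lra.
Qed.

(** A quantitative form of nonpositive logarithmic norm: [(|1 + h T| - 1) / h <= c h]. *)
Definition dissipative T := exists2 c, 0 <= c &
  forall h, 0 <= h -> bnd (1 + c * h ^+ 2) (euler_step T h).

(** The Euler step of the sum is the average of the Euler steps of the summands with step size
    [2 h]. *)
Lemma dissipativeD T T' : dissipative T -> dissipative T' ->
  dissipative (fun X => T X + T' X).
Proof.
move=> [c c0 Tc] [c' c'0 Tc']; exists (2 * (c + c')) => [|h h0 X].
  by rewrite mulr_ge0 // addr_ge0.
have h20 : 0 <= 2 * h by rewrite mulr_ge0.
have -> : euler_step (fun X => T X + T' X) h X =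
    (2^-1)%:C%C *: (euler_step T (2 * h) X + euler_step T' (2 * h) X).
  apply/matrixP=> i j; rewrite !mxE fmorphV rmorphM rmorph_nat.
  by field.
have i2 : (0 : R) <= 2^-1 by rewrite invr_ge0.
rewrite tnZ (ger0_norm i2).
apply: (le_trans (ler_wpM2l i2 (le_tnD (Tc _ h20 X) (Tc' _ h20 X)))).
move: (tn X) => n; lra.
Qed.

Lemma dissipativeZ T a : 0 <= a -> dissipative T -> dissipative (scaleS a T).
Proof.
move=> a0 [c c0 Tc]; exists (c * a ^+ 2) => [|h h0 X].
  by rewrite mulr_ge0 // sqr_ge0.
have := Tc _ (mulr_ge0 h0 a0) X.
rewrite /euler_step /scaleS scalerA -rmorphM exprMn mulrA.
by rewrite mulrAC.
Qed.

Lemma taylor2_iter_euler T y c h m : linear T -> 0 <= y -> 0 <= h -> 0 <= c -> bnd y T ->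
  bnd (1 + c * h ^+ 2) (euler_step T h) ->
  taylor2 (iter m (euler_step T h)) (fun X => (m%:R * h)%:C%C *: T X)
    (fun X => ('C(m, 2)%:R * h ^+ 2)%:C%C *: T (T X)) (m%:R * (h * y))
    ((1 + c * h ^+ 2) ^+ m).
Proof.
move=> lT y0 h0 c0 Ty Tc; have hy0 : 0 <= h * y by rewrite mulr_ge0.
(* A single step has no terms beyond first order. The second order term of the iterate arises by
   composition, with coefficients given by Pascal's rule. *)
have step : taylor2 (euler_step T h) (fun X => h%:C%C *: T X) (fun=> 0) (h * y)
    (1 + c * h ^+ 2).
  have g1 : 1 <= 1 + c * h ^+ 2 by rewrite lerDl mulr_ge0 ?sqr_ge0.
  have g0 := le_trans ler01 g1.
  have T1 : bnd (h * y) (fun X => h%:C%C *: T X).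
    by move=> X; rewrite tnZ (ger0_norm h0) -mulrA; exact: ler_wpM2l (Ty X).
  have sE X : euler_step T h X - X = h%:C%C *: T X by rewrite /euler_step addrC addKr.
  split=> //.
  - exact: euler_stepD.
  - move=> X; rewrite sE; apply: (le_trans (T1 X)).
    by apply: ler_wpM2r; [exact: tn_ge0 | exact: ler_peMl].
  - move=> X; rewrite sE subrr tn0.
    by rewrite !mulr_ge0 ?tn_ge0 ?sqr_ge0 // invr_ge0.
  - move=> X; rewrite sE !subrr tn0.
    by rewrite !mulr_ge0 ?tn_ge0 ?exprn_ge0 // invr_ge0.
  - by move=> X; rewrite tn0 !mulr_ge0 ?tn_ge0 ?sqr_ge0 // invr_ge0.
elim: m => [|m IH].
  split=> //=; rewrite ?mul0r ?expr0 // => X; do ?[by rewrite mul1r |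
    by rewrite ?bin0n ?mul0r ?rmorph0 ?scale0r ?subr0 ?subrr ?tn0 ?expr0n /= ?mul0r ?mulr0 ?mul0r].
have := taylor2_comp step IH.
rewrite -exprS; congr (taylor2 _ _ _ _ _).
- apply/funext => X; rewrite -scalerDl -rmorphD; congr (_%:C%C *: _).
  by rewrite -natr1; ring.
- apply/funext => X; rewrite add0r (linZ lT) scalerA -scalerDl -rmorphM -rmorphD.
  by congr (_%:C%C *: _); rewrite binS bin1 natrD; ring.
- by rewrite -natr1; ring.
Qed.

(** The Euler products satisfy the bounds with a factor [g <= 1 + K'/M], which tends to 1. *)
Lemma taylor2_expS T y : linear T -> 0 <= y -> bnd y T -> dissipative T ->
  taylor2 (expS T) T (fun X => (2^-1)%:C%C *: T (T X)) y 1.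
Proof.
move=> lT y0 Ty [c c0 Tc].
pose K := y ^+ 2 * expR y ^+ 2; pose K' := c * expR c.
have K0 : 0 <= K by rewrite mulr_ge0 ?sqr_ge0.
have K'0 : 0 <= K' by rewrite mulr_ge0 ?expR_ge0.
have tay M : (0 < M)%N -> exists g, [/\ g <= 1 + K' / M%:R &
    taylor2 (euler T M) T (fun X => ('C(M, 2)%:R * M%:R^-1 ^+ 2)%:C%C *: T (T X)) y g].
  move=> M0; have M0' : (M%:R : R) != 0 by rewrite pnatr_eq0 -lt0n.
  exists ((1 + c * M%:R^-1 ^+ 2) ^+ M); split; first exact: compound_sq_le.
  have h0 : (0 : R) <= M%:R^-1 by rewrite invr_ge0.
  have := taylor2_iter_euler M lT y0 h0 c0 Ty (Tc _ h0).
  rewrite mulrA divff // mul1r; congr (taylor2 _ _ _ _ _).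
  by apply/funext => X; rewrite rmorph1 scale1r.
(* Transfers a bound from approximants to [A]: both the excess of [g] over 1 and the distance to [A]
   are of order [1/M]. *)
have lim (a : R) A (F : nat -> superop R) :
    0 <= a -> (forall M, (0 < M)%N -> forall g, taylor2 (euler T M) T
      (fun X => ('C(M, 2)%:R * M%:R^-1 ^+ 2)%:C%C *: T (T X)) y g -> bnd (g * a) (F M)) ->
    (exists k, forall M X, (0 < M)%N -> tn (A X - F M X) <= k / M%:R * tn X) ->
    bnd (1 * a) A.
  move=> a0 FM [k kM] X; apply: (@le_of_le_add_inv _ _ _ ((k + K' * a) * tn X)) => M M0.
  have [g [gK /FM -/(_ M0 X) FX]] := tay M M0.
  have : g * (a * tn X) <= (1 + K' / M%:R) * (a * tn X).
    by rewrite ler_wpM2r // mulr_ge0 ?tn_ge0.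
  rewrite -(subrK (F M X) (A X)) => gaX.
  apply: (le_trans (le_tnD (kM M X M0) FX)).
  move: gaX; move: (tn X) (M%:R^-1) => n iM; lra.
have subBB (u v w : V) : u - w - (v - w) = u - v by rewrite opprB addrA subrK.
have exE M X : (0 < M)%N -> tn (expS T X - euler T M X) <= K / M%:R * tn X.
  by move=> M0; exact: (tn_expS_euler lT y0 Ty X M0).
split=> //.
- exact: (expSD lT y0 Ty).
- rewrite -(mulr1 1); apply: (lim _ _ (euler T)) => // [M _ g []|].
    by rewrite mulr1.
  by exists K.
- apply: (lim _ _ (fun M X => euler T M X - X)) => // [M _ g []//|].
  by exists K => M X M0; rewrite subBB exE.
- apply: (lim _ _ (fun M X => euler T M X - X - T X)) => [|M _ g []//|].
    by rewrite divr_ge0 ?sqr_ge0.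
  exists K => M X M0.
  by rewrite !subBB exE.
- apply: (lim _ _ (fun M X => euler T M X - X - T X -
    ('C(M, 2)%:R * M%:R^-1 ^+ 2)%:C%C *: T (T X))) => [|M _ g []//|].
    by rewrite divr_ge0 ?exprn_ge0.
  (* [K] bounds the Euler error; the other summand comes from the second order coefficient, as
     [C(M,2) / M^2] falls short of [1/2] by [1/(2 M)]. *)
  exists (K + 2^-1 * y ^+ 2) => M X M0.
  set a := expS T X; set b := euler T M X; set d := 'C(_, _)%:R * _.
  have -> : a - X - T X - (2^-1)%:C%C *: T (T X) - (b - X - T X - d%:C%C *: T (T X))
     = (a - b) - (2^-1 - d)%:C%C *: T (T X).
    move: a b (T X) (T (T X)) => a b TX TTX.
    by rewrite rmorphB scalerBl; apply/matrixP=> i j; rewrite !mxE; ring.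
  have dE : 2^-1 - d = 2^-1 / M%:R.
    have bE : 'C(M, 2)%:R = M%:R * (M%:R - 1) / 2 :> R.
      have M1 : M.-1%:R = M%:R - 1 :> R by rewrite -{2}(prednK M0) -natr1 addrK.
      by rewrite -M1 -natrM -{1}(bin1 M.-1) mul_bin_diag natrM mulrC mulKf ?pnatr_eq0.
    by rewrite /d bE; field; rewrite pnatr_eq0 -lt0n.
  have M0' : (0 : R) <= 2^-1 / M%:R by rewrite divr_ge0 // invr_ge0.
  rewrite dE; apply: (le_trans (le_tnB (exE M X M0) (lexx _))).
  rewrite tnZ (ger0_norm M0').
  have := ler_wpM2l M0' (tn_iter y0 Ty 2 X); rewrite /=.
  move: (tn (T (T X))) (tn X) (M%:R^-1) => n2 n iM; lra.
- move=> X; have i2 : (0 : R) <= 2^-1 by rewrite invr_ge0.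
  rewrite tnZ (ger0_norm i2); have := ler_wpM2l i2 (tn_iter y0 Ty 2 X); rewrite /=.
  move: (tn (T (T X))) (tn X) => n2 n; lra.
Qed.
End Taylor.

(** * Lindblad generators are dissipative *)

Section Lindblad.
Variable R : realType.
Local Notation C := R[i].
Local Notation V := 'M[C]_2.
Local Notation tn := (@tracenorm R).
Implicit Types (X Y U K G L A : V) (T : superop R) (c h : R).

(** The hypothesis is [K^* K + h L^* L <= c] as a quadratic form. Under it the dual map
    [W |-> K^* W K + h L^* W L] sends contractions to operators of norm at most [c]. *)
Lemma tn_kraus K L c h X : 0 <= h ->
  (forall U, hsn (K *m U) + h * hsn (L *m U) <= c * hsn U) ->
  tn (K *m X *m adjmx K + h%:C%C *: (L *m X *m adjmx L)) <= c * tn X.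
Proof.
move=> h0 cKL; set Z := _ + _; have [W W1 <-] := tracenorm_attained Z.
have -> : rtr (W *m Z) =
    rtr ((adjmx K *m W *m K + h%:C%C *: (adjmx L *m W *m L)) *m X).
  rewrite /Z mulmxDr mulmxDl -scalemxAr -scalemxAl !rtrD !rtrZ.
  by rewrite !mulmxA (rtrC _ (adjmx K)) (rtrC _ (adjmx L)) !mulmxA.
apply: rtr_le_tracenorm => U Y.
have -> : rtr (adjmx U *m (adjmx K *m W *m K + h%:C%C *: (adjmx L *m W *m L)) *m Y)
    = rtr (adjmx (K *m U) *m W *m (K *m Y)) + h * rtr (adjmx (L *m U) *m W *m (L *m Y)).
  by rewrite mulmxDr mulmxDl -scalemxAr -scalemxAl rtrD rtrZ !adjmxM !mulmxA.
have := W1 (K *m U) (K *m Y); have := ler_wpM2l h0 (W1 (L *m U) (L *m Y)).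
have := cKL U; have := cKL Y.
move: (rtr (adjmx (K *m U) *m W *m (K *m Y))) (rtr (adjmx (L *m U) *m W *m (L *m Y))).
move: (hsn (K *m U)) (hsn (K *m Y)) (hsn (L *m U)) (hsn (L *m Y)) (hsn U) (hsn Y).
move=> ku ky lu ly u y' p q; lra.
Qed.

Lemma hsn_mul_bounded A : exists2 b, 0 <= b & forall U, hsn (A *m U) <= b * hsn U.
Proof.
pose good (B : V) := exists2 b, 0 <= b & forall U, hsn (B *m U) <= b * hsn U.
have g0 : good 0.
  by exists 0 => // U; rewrite mul0mx mul0r -(scale0r (0 : V)) hsnZ /= expr0n /= addr0 mul0r.
have gD B B' : good B -> good B' -> good (B + B').
  move=> [b b0 Bb] [b' b'0 Bb']; exists (2 * b + 2 * b') => [|U]; first lra.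
  rewrite mulmxDl hsnD; have := hsn_young (B *m U) (B' *m U).
  have := Bb U; have := Bb' U.
  move: (hsn (B *m U)) (hsn (B' *m U)) (hsn U) (rtr _) => p q u r; lra.
rewrite -/(good A) [A]matrix_sum_delta.
apply: (big_ind good g0 gD) => i _; apply: (big_ind good g0 gD) => j _.
exists (complex.Re (A i j) ^+ 2 + complex.Im (A i j) ^+ 2) => [|U].
  by rewrite addr_ge0 ?sqr_ge0.
rewrite -scalemxAl hsnZ ler_wpM2l ?addr_ge0 ?sqr_ge0 //.
rewrite -[delta_mx i j]scale1r hsn_delta //=; lra.
Qed.

(* With K = 1 + h G one has K X K^* + h L X L^* = X + h T(X) + h^2 G X G^*, and
   G + G^* + L^* L = 0 makes the Kraus operators trace preserving up to h^2. *)
Lemma dissipative_lindblad G L : G + adjmx G + adjmx L *m L = 0 ->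
  dissipative (fun X => G *m X + X *m adjmx G + L *m X *m adjmx L).
Proof.
move=> GL0; have [b b0 Gb] := hsn_mul_bounded G.
(* One [b] comes from the trace preservation defect of the Kraus operators, the other from the
   correction [h^2 G X G^*]. *)
exists (2 * b) => [|h h0 X]; first lra.
pose K : V := 1%:M + h%:C%C *: G.
have KE : adjmx K = 1%:M + h%:C%C *: adjmx G.
  by rewrite adjmxD adjmx1 adjmxZ conj_realC.
have GE U : rtr (adjmx U *m G *m U) *+ 2 + hsn (L *m U) = 0.
  have : rtr (adjmx U *m (G + adjmx G + adjmx L *m L) *m U) = 0.
    by rewrite GL0 mulmx0 mul0mx /rtr mxtrace0.
  rewrite !mulmxDr !mulmxDl !rtrD.
  have -> : rtr (adjmx U *m adjmx G *m U) = rtr (adjmx U *m G *m U).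
    by rewrite -rtr_adj !adjmxM !adjmxK mulmxA.
  by rewrite /hsn adjmxM !mulmxA mulr2n.
(* In [|U + h G U|^2 + h |L U|^2] the terms linear in [h] cancel by [GE], which leaves
   [|U|^2 + h^2 |G U|^2]. *)
have e1 : tn (K *m X *m adjmx K + h%:C%C *: (L *m X *m adjmx L)) <= (1 + b * h ^+ 2) * tn X.
  apply: tn_kraus => // U; rewrite /K mulmxDl mul1mx -scalemxAl hsnD hsnZ -scalemxAr rtrZ /=.
  rewrite mulmxA; have := GE U; have := Gb U; have : 0 <= h ^+ 2 by exact: sqr_ge0.
  move: (hsn U) (hsn (G *m U)) (hsn (L *m U)) (rtr _) => u gu lu r h2 gb rE.
  have := ler_wpM2l h2 gb; have -> : lu = - (r *+ 2) by lra.
  lra.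
have e2 : tn (G *m X *m adjmx G) <= b * tn X.
  have := @tn_kraus G 0 b 0 X (lexx _); rewrite scale0r addr0; apply => U.
  by rewrite mul0r addr0.
have -> : euler_step (fun X => G *m X + X *m adjmx G + L *m X *m adjmx L) h X =
    K *m X *m adjmx K + h%:C%C *: (L *m X *m adjmx L)
    - (h ^+ 2)%:C%C *: (G *m X *m adjmx G).
  rewrite /euler_step KE /K !mulmxDl !mulmxDr !mul1mx !mulmx1.
  rewrite -?scalemxAl -?scalemxAr -?scalemxAl rmorphXn /=.
  move: (G *m X *m adjmx G) (L *m X *m adjmx L) (G *m X) (X *m adjmx G) => p q r s.
  by apply/matrixP=> i j; rewrite !mxE; ring.
apply: (le_trans (le_tnB e1 (lexx _))); rewrite tnZ ger0_norm ?sqr_ge0 //.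
have := ler_wpM2l (sqr_ge0 h) e2.
move: (tn (G *m X *m adjmx G)) (tn X) => m n {e1 e2}; lra.
Qed.

Lemma dissipative0 : dissipative (fun=> 0 : V).
Proof. by exists 0 => // h _ X; rewrite /euler_step scaler0 !addr0 mul0r addr0 mul1r. Qed.

Lemma dissipative_sum I (r : seq I) (F : I -> superop R) :
  (forall i, dissipative (F i)) -> dissipative (fun X => \sum_(i <- r) F i X).
Proof.
move=> dF; elim: r => [|i r IH].
  have -> : (fun X => \sum_(i <- [::]) F i X) = (fun=> 0).
    by apply/funext => X; exact: big_nil.
  exact: dissipative0.
have -> : (fun X => \sum_(j <- i :: r) F j X) = (fun X => F i X + \sum_(j <- r) F j X).
  by apply/funext => X; exact: big_cons.
exact: dissipativeD (dF i) IH.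
Qed.

Lemma adj_pauli k : adjmx (pauli R k) = pauli R k.
Proof.
rewrite /pauli; case: (val k) => [|[|n]]; apply/matrixP => i j; rewrite !mxE eq_sym.
- by case: ifP; rewrite ?rmorph1 ?rmorph0.
- have [_|] := eqVneq i j; first by rewrite rmorph0.
  by case: i j => [[|[|i]] //= hi] [[|[|j]] //= hj] _;
    rewrite ?complexiE ?rmorphN /= ?conjCi ?opprK.
- have [->|_] := eqVneq i j; last by rewrite rmorph0.
  by case: ifP => _; rewrite ?rmorphN ?rmorph1.
Qed.

Lemma comm2D_r A X Y : comm2 A (X + Y) = comm2 A X + comm2 A Y.
Proof. by rewrite /comm2 mulmxDr mulmxDl opprD addrACA. Qed.

Lemma comm2Z_r a A X : comm2 A (a *: X) = a *: comm2 A X.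
Proof. by rewrite /comm2 -scalemxAr -scalemxAl scalerBr. Qed.

Lemma comm2D_l A X Y : comm2 (X + Y) A = comm2 X A + comm2 Y A.
Proof. by rewrite /comm2 mulmxDr mulmxDl opprD addrACA. Qed.

Lemma comm2Z_l a A X : comm2 (a *: X) A = a *: comm2 X A.
Proof. by rewrite /comm2 -scalemxAr -scalemxAl scalerBr. Qed.

Lemma L0_linear A : linear (L0 A).
Proof.
by move=> a X Y; rewrite /L0 comm2D_r comm2Z_r scalerDr !scalerA mulrC.
Qed.

Lemma L0_dissipative A : herm_mx A -> dissipative (L0 A).
Proof.
(* Lindblad form with [G = -i A] and no jump operator; [G] is anti-Hermitian. *)
move=> hA; have -> : L0 A = fun X => (- 'i%C *: A) *m X + X *m adjmx (- 'i%C *: A)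
    + 0 *m X *m adjmx 0.
  apply/funext => X; rewrite /L0 /comm2 !mul0mx addr0 adjmxZ hA -scalemxAl -scalemxAr.
  rewrite scalerBr; congr (_ + _); rewrite -scaleNr; congr (_ *: _).
  by rewrite complexiE rmorphN /= conjCi.
apply: dissipative_lindblad; rewrite adjmxZ hA mulmx0 addr0 -scalerDl.
have -> : - 'i%C + Num.conj (- 'i%C) = 0 :> C.
  by rewrite complexiE rmorphN /= conjCi opprK addNr.
by rewrite scale0r.
Qed.

Lemma LB_linear B : linear (@LB R B).
Proof.
move=> a X Y; rewrite /LB scalerA mulrC -scalerA -scalerDr; congr (_ *: _).
rewrite scaler_sumr -big_split; apply: eq_bigr => i _ /=.
rewrite scaler_sumr -big_split; apply: eq_bigr => j _ /=.
rewrite scalerA (mulrC a) -scalerA -scalerDr; congr (_ *: _).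
rewrite mulmxDl mulmxDr comm2D_l comm2D_r -scalemxAl -scalemxAr comm2Z_l comm2Z_r.
by rewrite addrACA -scalerDr.
Qed.

(** A Hermitian idempotent satisfies [B = B B^*]. This splits the double sum into Lindblad
    generators with jump operators [L l], the combinations of Pauli matrices given by the columns of
    [B]. *)
Lemma LB_dissipative B : herm_mx B -> B *m B = B -> dissipative (@LB R B).
Proof.
move=> hB BB.
pose L l : V := \sum_i B i l *: pauli R i.
have LE l : adjmx (L l) = \sum_j Num.conj (B j l) *: pauli R j.
  rewrite /L (big_morph (@adjmx R 2 2) (@adjmxD R 2 2) (@adjmx0 R 2 2)).
  by apply: eq_bigr => j _; rewrite adjmxZ adj_pauli.
pose G l : V := - (2^-1)%:C%C *: (adjmx (L l) *m L l).
have -> : LB B = fun X => \sum_l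
    (G l *m X + X *m adjmx (G l) + L l *m X *m adjmx (L l)).
  apply/funext => X; pose F (Y Z : V) : V := comm2 Y (X *m Z) + comm2 (Y *m X) Z.
  have FDl Z : {morph F^~ Z : Y Y' / Y + Y'}.
    by move=> Y Y'; rewrite /F mulmxDl !comm2D_l /= [LHS]addrACA.
  have FDr Y : {morph F Y : Z Z' / Z + Z'}.
    by move=> Z Z'; rewrite /F mulmxDr !comm2D_r /= [LHS]addrACA.
  have FZl a Y Z : F (a *: Y) Z = a *: F Y Z.
    by rewrite /F -scalemxAl !comm2Z_l -scalerDr.
  have FZr a Y Z : F Y (a *: Z) = a *: F Y Z.
    by rewrite /F -scalemxAr !comm2Z_r -scalerDr.
  have F0l Z : F 0 Z = 0 by have := FZl 0 0 Z; rewrite !scale0r.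
  have F0r Y : F Y 0 = 0 by have := FZr 0 Y 0; rewrite !scale0r.
  (* The two commutators add up to [2 L X L^* - X L^* L - L^* L X]. *)
  have lE l : G l *m X + X *m adjmx (G l) + L l *m X *m adjmx (L l)
      = (2^-1)%:C%C *: F (L l) (adjmx (L l)).
    rewrite /G adjmxZ rmorphN /= conj_realC adjmxM adjmxK -scalemxAl -scalemxAr.
    rewrite /F /comm2 fmorphV rmorph_nat !mulmxA.
    move: (L l *m X *m adjmx (L l)) (X *m adjmx (L l) *m L l) (adjmx (L l) *m L l *m X).
    by move=> p q r; apply/matrixP=> i j; rewrite !mxE; field.
  rewrite (eq_bigr _ (fun l _ => lE l)) -scaler_sumr /LB fmorphV rmorph_nat.
  congr (_ *: _); have FLE l : F (L l) (adjmx (L l)) =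
      \sum_i \sum_j (B i l * Num.conj (B j l)) *: F (pauli R i) (pauli R j).
    rewrite LE /L (big_morph _ (FDl _) (F0l _)); apply: eq_bigr => i _.
    rewrite FZl (big_morph _ (FDr _) (F0r _)) scaler_sumr; apply: eq_bigr => j _.
    by rewrite FZr scalerA.
  rewrite (eq_bigr _ (fun l _ => FLE l)) [RHS]exchange_big; apply: eq_bigr => i _ /=.
  rewrite [RHS]exchange_big; apply: eq_bigr => j _ /=; rewrite -scaler_suml.
  congr (_ *: _); rewrite -{1}BB -{2}hB mxE; apply: eq_bigr => l _.
  by rewrite mxE.
apply: dissipative_sum => l; apply: dissipative_lindblad.
rewrite /G adjmxZ rmorphN /= conj_realC adjmxM adjmxK fmorphV rmorph_nat.
by apply/matrixP=> i j; rewrite !mxE; field.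
Qed.
End Lindblad.

(** * Error of the symmetric splitting for dissipative generators *)

Section Strang.
Variable R : realType.
Local Notation C := R[i].
Local Notation V := 'M[C]_2.
Local Notation tn := (@tracenorm R).
Implicit Types (X Y : V) (T K A B P Q : superop R) (a m : R).

Lemma scaleS_linear a T : linear T -> linear (scaleS a T).
Proof.
move=> lT c X Y; rewrite /scaleS (linD lT) (linZ lT) scalerDr !scalerA.
by rewrite [c * _]mulrC.
Qed.

Lemma addS_linear T T' : linear T -> linear T' -> linear (fun X => T X + T' X).
Proof.
move=> lT lT' c X Y; rewrite (linD lT) (linD lT') (linZ lT) (linZ lT') scalerDr.
by rewrite [LHS]addrACA.
Qed.

Lemma zeroS_linear : linear (fun _ : V => 0 : V).
Proof. by move=> c X Y; rewrite scaler0 addr0. Qed.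

(** The core of the nested palindromes; the second order term is written in the shape that
    [taylor2_sandwich] expects. *)
Lemma taylor2_id : taylor2 id (fun=> 0 : V) (fun=> (2^-1)%:C%C *: (0 : V)) 0 1.
Proof.
split=> // X; rewrite ?scaler0 ?subrr ?subr0 ?tn0 ?expr0n /= ?mul0r ?mul1r ?mul0r //.
Qed.

Definition palS A B : superop R := fun X => A X + B X + A X.

Lemma palS_linear A B : linear A -> linear B -> linear (palS A B).
Proof. by move=> lA lB; exact: addS_linear (addS_linear lA lB) lA. Qed.

(* Palindromic products have the second order term of an exponential. *)
Lemma taylor2_sandwich P A y g Q B z g' : linear A -> linear B ->
  taylor2 P A (fun X => (2^-1)%:C%C *: A (A X)) y g ->
  taylor2 Q B (fun X => (2^-1)%:C%C *: B (B X)) z g' ->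
  taylor2 (P \o Q \o P) (palS A B) (fun X => (2^-1)%:C%C *: palS A B (palS A B X))
    (y + z + y) (g * g' * g).
Proof.
move=> lA lB tP tQ; have := taylor2_comp (taylor2_comp tP tQ) tP.
congr (taylor2 _ _ _ _ _); apply/funext => X.
rewrite /palS !(linD lA) !(linD lB) fmorphV rmorph_nat.
move: (A (A X)) (A (B X)) (B (A X)) (B (B X)) => p q r s.
by apply/matrixP=> i j; rewrite !mxE; field.
Qed.

(** The common terms cancel, and each third order remainder contributes [y^3/6]. *)
Lemma taylor2_close P Q A1 A2 y : taylor2 P A1 A2 y 1 -> taylor2 Q A1 A2 y 1 ->
  bnd (y ^+ 3 / 3) (fun X => P X - Q X).
Proof.
move=> tP tQ X.
have -> : P X - Q X = (P X - X - A1 X - A2 X) - (Q X - X - A1 X - A2 X).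
  by apply/matrixP=> i j; rewrite !mxE; ring.
apply: (le_trans (le_tnB (taylor2_rem3 tP X) (taylor2_rem3 tQ X))).
move: (tn X) => n; rewrite le_eqVlt; apply/orP; left; apply/eqP.
by field.
Qed.

Lemma taylor2_scaled_expS T a m : linear T -> dissipative T -> bnd m T -> 0 <= m ->
  0 <= a -> taylor2 (expS (scaleS a T)) (scaleS a T)
    (fun X => (2^-1)%:C%C *: scaleS a T (scaleS a T X)) (a * m) 1.
Proof.
move=> lT dT mT m0 a0; apply: taylor2_expS.
- exact: scaleS_linear.
- exact: mulr_ge0.
- by move=> X; rewrite /scaleS tnZ (ger0_norm a0) -mulrA; exact: ler_wpM2l (mT X).
- exact: dissipativeZ.
Qed.

Lemma strang_splitting_error K0 K1 K2 K3 a m :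
  linear K0 -> linear K1 -> linear K2 -> linear K3 ->
  dissipative K0 -> dissipative K1 -> dissipative K2 -> dissipative K3 ->
  bnd m K0 -> bnd m K1 -> bnd m K2 -> bnd m K3 -> 0 <= m -> 0 <= a ->
  let E K := expS (scaleS (a / 2) K) in
  bnd ((4 * a * m) ^+ 3 / 3) (fun X =>
    expS (scaleS a (fun Y => K0 Y + K1 Y + K2 Y + K3 Y)) X
    - (E K0 \o E K1 \o E K2 \o E K3 \o E K3 \o E K2 \o E K1 \o E K0) X).
Proof.
move=> l0 l1 l2 l3 d0 d1 d2 d3 b0 b1 b2 b3 m0 a0 E.
have a20 : 0 <= a / 2 by rewrite divr_ge0.
have t0 := taylor2_scaled_expS l0 d0 b0 m0 a20.
have t1 := taylor2_scaled_expS l1 d1 b1 m0 a20.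
have t2 := taylor2_scaled_expS l2 d2 b2 m0 a20.
have t3 := taylor2_scaled_expS l3 d3 b3 m0 a20.
pose S X := K0 X + K1 X + K2 X + K3 X.
have tS : taylor2 (expS (scaleS a S)) (scaleS a S)
    (fun X => (2^-1)%:C%C *: scaleS a S (scaleS a S X)) (a * (4 * m)) 1.
  apply: taylor2_scaled_expS.
  - exact: addS_linear (addS_linear (addS_linear l0 l1) l2) l3.
  - exact: dissipativeD (dissipativeD (dissipativeD d0 d1) d2) d3.
  - move=> X; apply: (le_trans (le_tnD (le_tnD (le_tnD (b0 X) (b1 X)) (b2 X)) (b3 X))).
    by move: (tn X) => n; rewrite le_eqVlt; apply/orP; left; apply/eqP; ring.
  - by rewrite mulr_ge0.
  - exact: a0.
have h0 := scaleS_linear (a / 2) l0; have h1 := scaleS_linear (a / 2) l1.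
have h2 := scaleS_linear (a / 2) l2; have h3 := scaleS_linear (a / 2) l3.
have k3 := palS_linear h3 zeroS_linear.
have k2 := palS_linear h2 k3; have k1 := palS_linear h1 k2.
(* The eight factors form four nested palindromes around the identity. *)
have t8 := taylor2_sandwich h0 k1 t0 (taylor2_sandwich h1 k2 t1
  (taylor2_sandwich h2 k3 t2 (taylor2_sandwich h3 zeroS_linear t3 taylor2_id))).
set A := (A in taylor2 _ A _ _ _) in t8.
have AE : A = scaleS a S.
  apply/funext => X; rewrite /A /palS /scaleS /S.
  have aE : a%:C%C = (a / 2)%:C%C + (a / 2)%:C%C :> C by rewrite -rmorphD -splitr.
  rewrite aE; move: (K0 X) (K1 X) (K2 X) (K3 X) => x0 x1 x2 x3.
  by apply/matrixP=> i j; rewrite !mxE; ring.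
(* Eight factors of size [a m / 2] give the same total [4 a m] as the four summands in [tS]. *)
have yE : a / 2 * m + (a / 2 * m + (a / 2 * m + (a / 2 * m + 0 + a / 2 * m) + a / 2 * m)
    + a / 2 * m) + a / 2 * m = a * (4 * m) by field.
move: t8; rewrite -/A AE yE !mulr1 => t8.
have -> : (4 * a * m) ^+ 3 / 3 = (a * (4 * m)) ^+ 3 / 3 by ring.
(* The two bracketings of the product are convertible; the exponentials are generalized so that
   conversion sees only compositions. *)
rewrite /E; move: t8; move: (expS (scaleS (a / 2) K0)) (expS (scaleS (a / 2) K1)).
move: (expS (scaleS (a / 2) K2)) (expS (scaleS (a / 2) K3)) => e2 e3 e0 e1 t8.
exact: taylor2_close tS t8.
Qed.
End Strang.

(** * The concrete generators and the error bound for [S2] *)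

Lemma Lhat_linear (R : realType) (H : 'M[R[i]]_2) (lam : 'I_3 -> R)
  (Ak : 'I_3 -> 'M[R[i]]_3) (k : 'I_4) : linear (Lhat H lam Ak k).
Proof.
rewrite /Lhat; case: (val k) => [|[|[|n]]]; first exact: L0_linear.
all: exact: scaleS_linear (@LB_linear _ _).
Qed.

Lemma Lhat_dissipative (R : realType) (H : 'M[R[i]]_2) (lam : 'I_3 -> R)
  (Ak : 'I_3 -> 'M[R[i]]_3) (k : 'I_4) : herm_mx H -> (forall k, 0 <= lam k) ->
  (forall k, herm_mx (Ak k)) -> (forall k, Ak k *m Ak k = Ak k) ->
  dissipative (Lhat H lam Ak k).
Proof.
move=> hH lam0 hA AA; rewrite /Lhat; case: (val k) => [|[|[|n]]].
  exact: L0_dissipative.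
all: exact: dissipativeZ (lam0 _) (LB_dissipative (hA _) (AA _)).
Qed.

Theorem lemma3 (R : realType) (H : 'M[R[i]]_2) (A : 'M[R[i]]_3)
  (lam : 'I_3 -> R) (Ak : 'I_3 -> 'M[R[i]]_3) (t : R) (N : nat) :
  herm_mx H ->
  psd_mx A ->
  (forall k, 0 <= lam k) ->
  (forall k, herm_mx (Ak k)) ->
  (forall k, Ak k *m Ak k = Ak k) ->
  (forall k, \rank (Ak k) = 1%N) ->
  (forall k l, k != l -> Ak k *m Ak l = 0) ->
  \sum_(k < 3) Ak k = 1%:M ->
  A = \sum_(k < 3) ((lam k)%:C)%C *: Ak k ->
  0 < t -> (0 < N)%N ->
  let tau := t / N%:R in
  let Lam := \big[Num.max/0]_(k < 4) opnorm11 (Lhat H lam Ak k) in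
  opnorm11 (fun X => expS (scaleS tau (fun Y => \sum_(k < 4) Lhat H lam Ak k Y)) X
                     - S2 H lam Ak tau X)
  <= (4 * t * Lam) ^+ 3 / (3 * (N%:R) ^+ 3).
Proof.
move=> hH _ lam0 hA AA _ _ _ _ t0 N0; cbv zeta.
set tau := t / N%:R; set Lam := \big[_/_]_(_ < _) _.
have N0' : 0 < N%:R :> R by rewrite ltr0n.
have tau0 : 0 <= tau by rewrite divr_ge0 ?ltW.
have Lam_ge k : opnorm11 (Lhat H lam Ak k) <= Lam by exact: le_bigmax.
have Lam0 : 0 <= Lam by exact: bigmax_ge_id.
have lin k : linear (Lhat H lam Ak k) by exact: Lhat_linear.
have dis k : dissipative (Lhat H lam Ak k) by exact: Lhat_dissipative.
have bL k : bnd Lam (Lhat H lam Ak k).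
  exact: bnd_le (Lam_ge k) (opnorm11_bnd (lin k)).
(* Since [tau = t / N], the factor [N^3] is absorbed and the bound becomes that of a single step of
   length [tau]. *)
have -> : (4 * t * Lam) ^+ 3 / (3 * N%:R ^+ 3) = (4 * tau * Lam) ^+ 3 / 3.
  by rewrite /tau; field; rewrite gt_eqF.
apply: opnorm11_le.
  by apply: divr_ge0; [apply/exprn_ge0/mulr_ge0/Lam0/mulr_ge0 | rewrite ler0n].
have := strang_splitting_error (lin 0) (lin 1) (lin 2) (lin 3) (dis 0) (dis 1) (dis 2)
  (dis 3) (bL 0) (bL 1) (bL 2) (bL 3) Lam0 tau0.
have -> : (fun Y => \sum_(k < 4) Lhat H lam Ak k Y) = (fun Y =>
    Lhat H lam Ak 0 Y + Lhat H lam Ak 1 Y + Lhat H lam Ak 2 Y + Lhat H lam Ak 3 Y).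
  by apply/funext => Y; rewrite !big_ord_recl big_ord0 addr0 !addrA;
    congr (_ + _ + _ + _); congr (Lhat _ _ _ _ _); exact/val_inj.
by [].
Qed.
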